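(* Let $m\in\mathbb{N}$, $\alpha_1,\dots,\alpha_m,\beta>0$ and $r,k_1,\dots,k_m\in\mathbb{N}$, and consider the $m$-coupled system of time-space fractional partial differential equations $$\frac{\partial^{\alpha_p}u_p}{\partial t^{\alpha_p}}=\hat G_p[u_1,\dots,u_m],\qquad p=1,2,\dots,m,$$ for $u_q=u_q(x,t)$, $q=1,\dots,m$, where $$\hat G_p[u_1,\dots,u_m]=G_p\left(x,u_1,\dots,u_m,\frac{\partial^{\beta}u_1}{\partial x^{\beta}},\dots,\frac{\partial^{\beta}u_m}{\partial x^{\beta}},\dots,\frac{\partial^{r\beta}u_1}{\partial x^{r\beta}},\dots,\frac{\partial^{r\beta}u_m}{\partial x^{r\beta}},\frac{\partial^{\beta+k_p}u_1}{\partial x^{\beta+k_p}},\dots,\frac{\partial^{\beta+k_p}u_m}{\partial x^{\beta+k_p}}\right)$$ and $G_1,\dots,G_m$ are given sufficiently smooth functions of their arguments (so the $\hat G_p$ are linear or nonlinear fractional differential operators in $x$). For $p=1,\dots,m$ let $\mathcal{W}^p_{n_p}=\left\{\sum_{j=1}^{n_p}a^p_j\varphi^p_j(x):(a^p_1,\dots,a^p_{n_p})\in\mathbb{R}^{n_p}\right\}$, $n_p\ge1$, be the finite-dimensional linear space over $\mathbb{R}$ spanned by linearly independent functions $\varphi^p_1,\dots,\varphi^p_{n_p}$. Suppose these spaces are invariant, that is, for every $p=1,\dots,m$, $\hat G_p[w_1,\dots,w_m]\in\mathcal{W}^p_{n_p}$ for all $(w_1,\dots,w_m)\in\mathcal{W}^1_{n_1}\times\dots\times\mathcal{W}^m_{n_m}$,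 and let $\Phi^p_j:\mathbb{R}^{n_1+\dots+n_m}\to\mathbb{R}$ ($j=1,\dots,n_p$, $p=1,\dots,m$) be the expansion coefficients defined by $$\hat G_p\left[\sum_{j=1}^{n_1}a^1_j\varphi^1_j(x),\dots,\sum_{j=1}^{n_m}a^m_j\varphi^m_j(x)\right]=\sum_{j=1}^{n_p}\Phi^p_j(a^1_1,\dots,a^1_{n_1},\dots,a^m_1,\dots,a^m_{n_m})\varphi^p_j(x)$$ for all $(a^q_1,\dots,a^q_{n_q})\in\mathbb{R}^{n_q}$, $q=1,\dots,m$. Then the $m$-coupled system has a solution of the form $$u_p(x,t)=\sum_{j=1}^{n_p}A^p_j(t)\varphi^p_j(x),\qquad p=1,2,\dots,m,$$ where the coefficients $A^p_j(t)$ satisfy the system of fractional ordinary differential equations $$\frac{d^{\alpha_p}A^p_j(t)}{dt^{\alpha_p}}=\Phi^p_j\left(A^1_1(t),\dots,A^1_{n_1}(t),\dots,A^m_1(t),\dots,A^m_{n_m}(t)\right),\qquad j=1,\dots,n_p,\ p=1,2,\dots,m;$$ that is, whenever the functions $A^p_j$ satisfy this system, $(u_1,\dots,u_m)$ is a solution of the $m$-coupled system.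
   Context: The time and space fractional derivatives $\partial^{\alpha}/\partial t^{\alpha}$ and $\partial^{\beta}/\partial x^{\beta}$ are taken in the Riemann–Liouville sense or in the Caputo sense, with lower terminal $0$, in the variable indicated with the other variable held fixed. For a function $g$ of one variable $t>0$ and order $\alpha>0$ with $n-1<\alpha<n$, $n\in\mathbb{N}$: - Riemann–Liouville: $\dfrac{1}{\Gamma(n-\alpha)}\dfrac{d^n}{dt^n}\displaystyle\int_0^t\frac{g(s)}{(t-s)^{\alpha-n+1}}\,ds$; - Caputo: $\dfrac{1}{\Gamma(n-\alpha)}\displaystyle\int_0^t\frac{g^{(n)}(s)}{(t-s)^{\alpha-n+1}}\,ds$; and if $\alpha=n\in\mathbb{N}$ both are the ordinary derivative $g^{(n)}(t)$. The variables range over $x>0$, $t>0$. All fractional derivatives appearing (of the $\varphi^p_j$ in $x$ and of the $A^p_j$ in $t$) are understood to exist. When $\hat G_p$ is applied to functions of $x$ alone, the same formula is used with $x$-derivatives of those functions; when applied to functions of $(x,t)$ it acts in $x$ for each fixed $t$. *)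

(* Defs.v *)
From mathcomp Require Import all_boot all_order all_algebra.
From mathcomp Require Import all_classical all_reals all_analysis.

Set Implicit Arguments.
Unset Strict Implicit.
Unset Printing Implicit Defensive.

Import Order.TTheory GRing.Theory Num.Theory.
Import numFieldNormedType.Exports.

Local Open Scope classical_set_scope.
Local Open Scope ring_scope.

(* Every function of one real variable below is a total function R -> R of
   which only the restriction to the open half-line ]0, +oo[ matters: iterated
   derivatives are taken at positive points and the integrals run over
   ]0, t[. *)

Definition Gamma (R : realType) (z : R) : R :=
  \int[@lebesgue_measure R]_(t in `]0, +oo[) (t `^ (z - 1) * expR (- t)).

(* The two admissible readings of the symbol d^a/dt^a. *)
Variant frac_sense := RiemannLiouville | Caputo.

(* For a > 0, the positive integer n such that n - 1 < a <= n. *)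
Definition frac_ceil (R : realType) (a : R) : nat := `|Num.ceil a|%N.

Definition frac_integrand (R : realType) (n : nat) (a : R) (g : R -> R)
    (t s : R) : R :=
  g s / (t - s) `^ (a - n%:R + 1).

Definition frac_integral (R : realType) (n : nat) (a : R) (g : R -> R)
    (t : R) : R :=
  \int[@lebesgue_measure R]_(s in `]0, t[) frac_integrand n a g t s.

Definition frac_deriv (R : realType) (sense : frac_sense) (a : R)
    (g : R -> R) (t : R) : R :=
  let n := frac_ceil a in
  if a == n%:R then derive1n n g t
  else match sense with
       | RiemannLiouville =>
           (Gamma (n%:R - a))^-1 * derive1n n (frac_integral n a g) t
       | Caputo =>
           (Gamma (n%:R - a))^-1 * frac_integral n a (derive1n n g) t
       end.

(* [frac_deriv], [derive1n] and the integral are total operators with default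
   values, so existence is a separate predicate. *)
Definition derivable_n_pos (R : realType) (n : nat) (g : R -> R) : Prop :=
  forall (i : nat) (t : R), (i < n)%N -> 0 < t -> derivable (derive1n i g) t 1.

Definition frac_integrable (R : realType) (n : nat) (a : R) (g : R -> R)
    : Prop :=
  forall t : R, 0 < t ->
    (@lebesgue_measure R).-integrable `]0, t[
      (EFin \o frac_integrand n a g t).

Definition frac_derivable (R : realType) (sense : frac_sense) (a : R)
    (g : R -> R) : Prop :=
  let n := frac_ceil a in
  if a == n%:R then derivable_n_pos n g
  else match sense with
       | RiemannLiouville =>
           frac_integrable n a g /\ derivable_n_pos n (frac_integral n a g)
       | Caputo =>
           derivable_n_pos n g /\ frac_integrable n a (derive1n n g)
       end.

(* Class C^l on an open subset U of a finite-dimensional space: all iterated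
   directional derivatives up to order l exist and those of order l are
   continuous. *)
Fixpoint of_class_C (R : realType) (V : normedModType R) (l : nat)
    (U : set V) (f : V -> R) : Prop :=
  match l with
  | 0%N => forall z : V, U z -> {for z, continuous f}
  | l'.+1 =>
      (forall z v : V, U z -> derivable f z v) /\
      (forall v : V, of_class_C l' U ('D_v f))
  end.

(* Arguments of each G_p: the point x, the values u_q, the r x m array of the
   derivatives of u_q of order beta, 2 beta, ..., r beta, and the derivatives
   of order beta + k_p. *)
Definition jet (R : realType) (m r : nat) : normedModType R :=
  (R * 'rV[R]_m * 'M[R]_(r, m) * 'rV[R]_m)%type.

Definition jet_pos (R : realType) (m r : nat) : set (jet R m r) :=
  [set z | 0 < z.1.1.1].

Definition frac_jet (R : realType) (m r : nat) (sense : frac_sense)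
    (beta : R) (kp : nat) (w : 'I_m -> R -> R) (x : R) : jet R m r :=
  (x,
   \row_q w q x,
   \matrix_(i < r, q < m) frac_deriv sense ((i.+1)%:R * beta) (w q) x,
   \row_q frac_deriv sense (beta + kp%:R) (w q) x).

Definition Ghat (R : realType) (m r : nat) (sense : frac_sense) (beta : R)
    (k : 'I_m -> nat) (G : 'I_m -> jet R m r -> R) (p : 'I_m)
    (w : 'I_m -> R -> R) (x : R) : R :=
  G p (frac_jet r sense beta (k p) w x).

(* All the derivatives occurring in the operators Ghat_1, ..., Ghat_m exist
   for the function g. *)
Definition x_derivatives_exist (R : realType) (m r : nat)
    (sense : frac_sense) (beta : R) (k : 'I_m -> nat) (g : R -> R) : Prop :=
  (forall i : nat, (1 <= i <= r)%N -> frac_derivable sense (i%:R * beta) g) /\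
  (forall p : 'I_m, frac_derivable sense (beta + (k p)%:R) g).

Definition lincomb (R : realType) (n : nat) (phi : 'I_n -> R -> R)
    (a : 'rV[R]_n) (x : R) : R :=
  \sum_(j < n) a 0 j * phi j x.

Definition span_pos (R : realType) (n : nat) (phi : 'I_n -> R -> R)
    : set (R -> R) :=
  [set w | exists a : 'rV[R]_n, forall x : R, 0 < x -> w x = lincomb phi a x].

Definition lin_indep_pos (R : realType) (n : nat) (phi : 'I_n -> R -> R)
    : Prop :=
  forall a : 'rV[R]_n, (forall x : R, 0 < x -> lincomb phi a x = 0) -> a = 0.

Definition invariant_spaces (R : realType) (m r : nat) (sense : frac_sense)
    (beta : R) (k : 'I_m -> nat) (G : 'I_m -> jet R m r -> R)
    (n : 'I_m -> nat) (phi : forall p : 'I_m, 'I_(n p) -> R -> R) : Prop :=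
  forall (p : 'I_m) (w : 'I_m -> R -> R),
    (forall q : 'I_m, span_pos (phi q) (w q)) ->
    span_pos (phi p) (Ghat sense beta k G p w).

(* A family [a : forall q, 'rV[R]_(n q)] is a point of R^(n_1 + ... + n_m). *)
Definition expansion_coefficients (R : realType) (m r : nat)
    (sense : frac_sense) (beta : R) (k : 'I_m -> nat)
    (G : 'I_m -> jet R m r -> R) (n : 'I_m -> nat)
    (phi : forall p : 'I_m, 'I_(n p) -> R -> R)
    (Phi : forall p : 'I_m, 'I_(n p) -> (forall q : 'I_m, 'rV[R]_(n q)) -> R)
    : Prop :=
  forall (a : forall q : 'I_m, 'rV[R]_(n q)) (p : 'I_m) (x : R), 0 < x ->
    Ghat sense beta k G p (fun q => lincomb (phi q) (a q)) x =
    \sum_(j < n p) Phi p j a * phi p j x.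

Definition solves_fode (R : realType) (m : nat) (sense : frac_sense)
    (alpha : 'I_m -> R) (n : 'I_m -> nat)
    (Phi : forall p : 'I_m, 'I_(n p) -> (forall q : 'I_m, 'rV[R]_(n q)) -> R)
    (A : forall p : 'I_m, 'I_(n p) -> R -> R) : Prop :=
  forall (p : 'I_m) (j : 'I_(n p)),
    frac_derivable sense (alpha p) (A p j) /\
    forall t : R, 0 < t ->
      frac_deriv sense (alpha p) (A p j) t =
      Phi p j (fun q => \row_i A q i t).

(* [u p x t] is u_p(x, t). *)
Definition solves_fpde (R : realType) (m r : nat)
    (sense_t sense_x : frac_sense) (alpha : 'I_m -> R) (beta : R)
    (k : 'I_m -> nat) (G : 'I_m -> jet R m r -> R)
    (u : 'I_m -> R -> R -> R) : Prop :=
  [/\ forall (p : 'I_m) (x : R), 0 < x ->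
        frac_derivable sense_t (alpha p) (fun t => u p x t),
      forall (q : 'I_m) (t : R), 0 < t ->
        x_derivatives_exist r sense_x beta k (fun x => u q x t)
    & forall (p : 'I_m) (x t : R), 0 < x -> 0 < t ->
        frac_deriv sense_t (alpha p) (fun s => u p x s) t =
        Ghat sense_x beta k G p (fun q y => u q y t) x].

(* Main.v *)
(* Fractional differentiation is linear on finite linear combinations of
   functions that have the derivative in question. Hence the time derivative
   of u_p is obtained by differentiating the A^p_j, the FODE turns the result
   into the sum of the Phi^p_j phi^p_j, and at each frozen time t the expansion
   identity says that this sum is Ghat_p applied to u(., t). *)
Require Import Defs.
From mathcomp Require Import all_boot all_order all_algebra.
From mathcomp Require Import all_classical all_reals all_analysis.

Set Implicit Arguments.
Unset Strict Implicit.
Unset Printing Implicit Defensive.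

Import Order.TTheory GRing.Theory Num.Theory.
Import numFieldNormedType.Exports.

Local Open Scope classical_set_scope.
Local Open Scope ring_scope.

(** A derivative at [t > 0] sees only values near [t], and the positive half-line is open. The
    separate [f] lets later lemmas insert functions, such as iterated derivatives or integrals,
    known to be combinations only at positive points. *)
Lemma is_derive_lincomb (R : realType) (N : nat) (g : 'I_N -> R -> R)
    (a : 'rV[R]_N) (f : R -> R) (t : R) :
  (forall s : R, 0 < s -> f s = lincomb g a s) -> 0 < t ->
  (forall j : 'I_N, derivable (g j) t 1) ->
  is_derive t 1 f (lincomb (fun j => derive1 (g j)) a t).
Proof.
move=> fE t_gt0 dg.
have nearE : \forall s \near t, (\sum_(j < N) (a 0 j \*: g j)) s = f s.
  near=> s; rewrite fE; last by near: s; exact: lt_nbhsr.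
  by rewrite fct_sumE.
have dag (j : 'I_N) : derivable (a 0 j \*: g j) t 1 by exact: derivableZ.
apply: DeriveDef.
  by apply: (near_eq_derivable nearE); exact: derivable_sum.
rewrite -(near_eq_derive _ nearE) derive_sum//; apply: eq_bigr => j _.
by rewrite deriveZ// derive1E.
Unshelve. all: by end_near. Qed.

(** Induction on the order: each stage yields an equality on the whole positive half-line, which is
    what the next differentiation requires. Derivability of the derivatives of order below [n]
    carries the formula up to order [n] included. *)
Lemma derive1n_lincomb (R : realType) (N n : nat) (g : 'I_N -> R -> R)
    (a : 'rV[R]_N) (f : R -> R) :
  (forall s : R, 0 < s -> f s = lincomb g a s) ->
  (forall j : 'I_N, derivable_n_pos n (g j)) ->
  forall (i : nat) (t : R), (i <= n)%N -> 0 < t ->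
    derive1n i f t = lincomb (fun j => derive1n i (g j)) a t.
Proof.
move=> fE dg; elim=> [|i IH] t lt_in t_gt0; first exact: fE.
have fiE s (s_gt0 : 0 < s) := IH s (ltnW lt_in) s_gt0.
have df := is_derive_lincomb fiE t_gt0 (fun j => dg j i t lt_in t_gt0).
by rewrite derive1nS derive1E derive_val.
Qed.

Lemma derivable_n_pos_lincomb (R : realType) (N n : nat) (g : 'I_N -> R -> R)
    (a : 'rV[R]_N) (f : R -> R) :
  (forall s : R, 0 < s -> f s = lincomb g a s) ->
  (forall j : 'I_N, derivable_n_pos n (g j)) -> derivable_n_pos n f.
Proof.
move=> fE dg i t lt_in t_gt0.
have fiE s (s_gt0 : 0 < s) := derive1n_lincomb fE dg (ltnW lt_in) s_gt0.
have df := is_derive_lincomb fiE t_gt0 (fun j => dg j i t lt_in t_gt0).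
exact: ex_derive.
Qed.

Lemma frac_integrand_lincomb (R : realType) (N n : nat) (b : R)
    (g : 'I_N -> R -> R) (a : 'rV[R]_N) (f : R -> R) (t : R) :
  (forall s : R, 0 < s -> f s = lincomb g a s) ->
  {in `]0, t[%classic, frac_integrand n b f t =1
    lincomb (fun j => frac_integrand n b (g j) t) a}.
Proof.
move=> fE s; rewrite inE/= in_itv/= => /andP[s_gt0 _].
rewrite /frac_integrand fE// /lincomb mulr_suml.
by apply: eq_bigr => j _; rewrite mulrA.
Qed.

(** Both conclusions go through one induction on [N], since splitting the integral at the last term
    uses integrability of the partial sum. *)
Lemma integrable_lincomb (d : measure_display) (T : measurableType d)
    (R : realType) (mu : {measure set T -> \bar R}) (D : set T) (N : nat)
    (h : 'I_N -> T -> R) (c : 'I_N -> R) :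
  measurable D -> (forall j : 'I_N, mu.-integrable D (EFin \o h j)) ->
  mu.-integrable D (EFin \o (fun x => \sum_(j < N) c j * h j x)) /\
  \int[mu]_(x in D) (\sum_(j < N) c j * h j x) =
  \sum_(j < N) c j * \int[mu]_(x in D) h j x.
Proof.
move=> mD; elim: N h c => [|N IH] h c hi.
  split; last first.
    under eq_Rintegral => x _ do rewrite big_ord0.
    by rewrite Rintegral_cst// mul0r big_ord0.
  apply: (eq_integrable mD (cst 0%E)); last exact: integrable0.
  by move=> x _ /=; rewrite big_ord0.
have [IH1 IH2] := IH _ (fun j => c (widen_ord (leqnSn N) j))
  (fun j => hi (widen_ord (leqnSn N) j)).
have hmax : mu.-integrable D (EFin \o (fun x => c ord_max * h ord_max x)).
  by apply: (eq_integrable mD _ _ _ (integrableZl mD (c ord_max) (hi ord_max))).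
split.
  apply: (eq_integrable mD _ _ _ (integrableD mD IH1 hmax)) => x _ /=.
  by rewrite -EFinD big_ord_recr.
rewrite big_ord_recr/= -IH2 -RintegralZl// -RintegralD//.
by apply: eq_Rintegral => x _; rewrite big_ord_recr.
Qed.

Lemma frac_integrable_lincomb (R : realType) (N n : nat) (b : R)
    (g : 'I_N -> R -> R) (a : 'rV[R]_N) (f : R -> R) :
  (forall s : R, 0 < s -> f s = lincomb g a s) ->
  (forall j : 'I_N, frac_integrable n b (g j)) -> frac_integrable n b f.
Proof.
move=> fE gi t t_gt0.
have [//|+ _] := integrable_lincomb (a 0) _ (fun j => gi j t t_gt0).
apply: eq_integrable => // s s0t /=.
by rewrite (frac_integrand_lincomb n b fE s0t).
Qed.

Lemma frac_integral_lincomb (R : realType) (N n : nat) (b : R)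
    (g : 'I_N -> R -> R) (a : 'rV[R]_N) (f : R -> R) :
  (forall s : R, 0 < s -> f s = lincomb g a s) ->
  (forall j : 'I_N, frac_integrable n b (g j)) ->
  forall t : R, 0 < t ->
    frac_integral n b f t = lincomb (fun j => frac_integral n b (g j)) a t.
Proof.
move=> fE gi t t_gt0.
rewrite /lincomb /frac_integral.
have [//|_ <-] := integrable_lincomb (a 0) _ (fun j => gi j t t_gt0).
exact/eq_Rintegral/frac_integrand_lincomb.
Qed.

(** Each sense composes differentiation and integration. The inner operation commutes with the
    combination at positive points, and this equality is the hypothesis of the lemmas on the outer
    one. *)
Lemma frac_deriv_lincomb (R : realType) (sense : frac_sense) (N : nat) (b : R)
    (g : 'I_N -> R -> R) (a : 'rV[R]_N) :
  (forall j : 'I_N, frac_derivable sense b (g j)) ->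
  frac_derivable sense b (lincomb g a) /\
  forall t : R, 0 < t ->
    frac_deriv sense b (lincomb g a) t =
    lincomb (fun j => frac_deriv sense b (g j)) a t.
Proof.
rewrite /frac_derivable /frac_deriv; set n := frac_ceil b.
(* Brings the factor [(Gamma (n%:R - b))^-1] inside the sum in both non-integer cases. *)
have scaleE (c : R) (h : 'I_N -> R -> R) t :
    c * lincomb h a t = lincomb (fun j s => c * h j s) a t.
  by rewrite /lincomb mulr_sumr; apply: eq_bigr => j _; rewrite mulrCA.
have gE (s : R) : 0 < s -> lincomb g a s = lincomb g a s by [].
case: ifP => _ dg.
  split; first exact: derivable_n_pos_lincomb gE dg.
  by move=> t; exact: derive1n_lincomb.
(* Riemann-Liouville comes first: integrate, then differentiate [n] times. The Caputo case below
   reverses the order. *)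
case: sense dg => dg.
  have gi j := (dg j).1; have dI j := (dg j).2.
  have IE := frac_integral_lincomb gE gi.
  split=> [|t t_gt0].
    split; first exact: frac_integrable_lincomb gE gi.
    exact: derivable_n_pos_lincomb IE dI.
  by rewrite (derive1n_lincomb IE dI)// scaleE.
have dgn j := (dg j).1; have gi j := (dg j).2.
have DE s (s_gt0 : 0 < s) := derive1n_lincomb gE dgn (leqnn n) s_gt0.
split=> [|t t_gt0].
  split; first exact: derivable_n_pos_lincomb gE dgn.
  exact: frac_integrable_lincomb DE gi.
by rewrite (frac_integral_lincomb DE gi)// scaleE.
Qed.

Theorem theorem2p7 (R : realType) (sense_t sense_x : frac_sense)
  (m r : nat) (alpha : 'I_m -> R) (beta : R) (k : 'I_m -> nat)
  (alpha_gt0 : forall p : 'I_m, 0 < alpha p) (beta_gt0 : 0 < beta)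
  (l : nat) (G : 'I_m -> jet R m r -> R)
  (G_smooth : forall p : 'I_m, of_class_C l (@jet_pos R m r) (G p))
  (n : 'I_m -> nat) (n_ge1 : forall p : 'I_m, (1 <= n p)%N)
  (phi : forall p : 'I_m, 'I_(n p) -> R -> R)
  (phi_indep : forall p : 'I_m, lin_indep_pos (phi p))
  (phi_derivable : forall (p : 'I_m) (j : 'I_(n p)),
      x_derivatives_exist r sense_x beta k (phi p j))
  (W_invariant : invariant_spaces sense_x beta k G phi)
  (Phi : forall p : 'I_m, 'I_(n p) -> (forall q : 'I_m, 'rV[R]_(n q)) -> R)
  (Phi_expansion : expansion_coefficients sense_x beta k G phi Phi) :
  forall A : forall p : 'I_m, 'I_(n p) -> R -> R,
    solves_fode sense_t alpha Phi A ->
    solves_fpde sense_t sense_x alpha beta k G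
      (fun p x t => \sum_(j < n p) A p j t * phi p j x).
Proof.
move=> A A_sol.
(* The same sum is read in two ways: at frozen [t] the numbers [A p j t] are the coefficients, at
   frozen [x] the numbers [phi p j x] are. *)
have uE t p : (fun x => \sum_(j < n p) A p j t * phi p j x) =
    lincomb (phi p) (\row_j A p j t).
  by apply/funext => x; apply: eq_bigr => j _; rewrite mxE.
have uEt x p : (fun t => \sum_(j < n p) A p j t * phi p j x) =
    lincomb (A p) (\row_j phi p j x).
  by apply/funext => t; apply: eq_bigr => j _; rewrite mxE mulrC.
have dt x p := frac_deriv_lincomb (\row_j phi p j x) (fun j => (A_sol p j).1).
split=> [p x _|q t _|p x t x_gt0 t_gt0].
- by rewrite uEt; exact: (dt x p).1.
- rewrite uE; split=> [i i1r|p].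
    exact: (frac_deriv_lincomb _ (fun j => (phi_derivable q j).1 i i1r)).1.
  exact: (frac_deriv_lincomb _ (fun j => (phi_derivable q j).2 p)).1.
- rewrite uEt (dt x p).2//.
  (* At frozen [t] every component becomes an element of its span with coordinates [A q i t], so the
     expansion identity applies at exactly the point where the equations for [A] evaluate [Phi]. *)
  under [X in Ghat _ _ _ _ _ X]eq_fun do rewrite uE.
  rewrite Phi_expansion//; apply: eq_bigr => j _.
  by rewrite mxE mulrC (A_sol p j).2.
Qed.
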